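(* Let $\lambda\in\mathfrak t_n^*\simeq\mathbb R^n$. If $\lambda$ is generic (i.e. $\langle\lambda,\alpha^\vee\rangle=\lambda_j-\lambda_k\notin\mathbb Z$ for all roots, that is, for all $j\ne k$), then for $i\in\{1,\dots,n-1\}$ $$\mathscr T^{L}_{i,s_i\lambda}\circ\mathscr T^{L}_{i,\lambda}=-y\,\mathrm{id}.$$ For arbitrary $\lambda$ and $i\in\{1,\dots,n-2\}$, $$\mathscr T^{L}_{i,s_{i+1}s_i\lambda}\circ\mathscr T^{L}_{i+1,s_i\lambda}\circ\mathscr T^{L}_{i,\lambda}=\mathscr T^{L}_{i+1,s_is_{i+1}\lambda}\circ\mathscr T^{L}_{i,s_{i+1}\lambda}\circ\mathscr T^{L}_{i+1,\lambda}.$$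
   Context: $\mathfrak t_n^*\simeq\mathbb R^n$ is the space of real characters of the diagonal torus of $\mathrm{GL}_n$, and $s_i=(i,i+1)\in S_n$ acts on $\lambda=(\lambda_1,\dots,\lambda_n)$ by exchanging $\lambda_i$ and $\lambda_{i+1}$. The operators $\mathscr T^{L}_{i,\lambda}$, $i\in\{1,\dots,n-1\}$, act on $\mathbb Z[\underline t^{\pm1},\underline x^{\pm1},y]=\mathbb Z[t_1^{\pm1},\dots,t_n^{\pm1},x_1^{\pm1},\dots,x_n^{\pm1},y]$ by $$\mathscr T^{L}_{i,\lambda}(f)=\frac{(1+y)\left(\frac{t_i}{t_{i+1}}\right)^{1-\lceil\lambda_i-\lambda_{i+1}\rceil}}{1-\frac{t_i}{t_{i+1}}}\,f+\frac{1+y\frac{t_{i+1}}{t_i}}{1-\frac{t_{i+1}}{t_i}}\,s_i^tf,$$ where $s_i^t$ exchanges $t_i$ and $t_{i+1}$ and fixes the $x$-variables and $y$. *)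

(* Defs.v *)
From HB Require Import structures.
From mathcomp Require Import all_boot all_order all_algebra fingroup perm.
From mathcomp Require Import generic_quotient ring.
From mathcomp Require Import boolp reals.
From mathcomp Require Import mpoly.

Set Implicit Arguments.
Unset Strict Implicit.
Unset Printing Implicit Defensive.

Import Order.TTheory GRing.Theory Num.Theory.
Local Open Scope ring_scope.

(* Z[t_1..t_n, x_1..x_n, y]: the indeterminates are ordered t, x, y. *)
Notation poly_txy n := {mpoly int[n + n + 1]}.
Notation ratfun_txy n := {fraction (poly_txy n)}.

Lemma TF_split (F : fieldType) (y a b U f s : F) :
  a != 0 -> b != 0 -> b - a != 0 ->
  (1 + y) * U / (1 - a / b) * f + (1 + y * (b / a)) / (1 - b / a) * s =
  (1 + y) * ((U - 1) / (1 - a / b)) * f + (1 + y) * b * ((f - s) / (b - a)) + s.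
Proof.
move=> a0 b0 d0; have d0' : a - b != 0 by rewrite -opprB oppr_eq0.
by field; rewrite a0 b0 d0 d0'.
Qed.

Section LaurentRing.
Variable n : nat.

Local Notation P := (poly_txy n).
Local Notation K := (ratfun_txy n).
Local Notation "p %:F" := (@tofrac P p).

Definition t_idx (k : 'I_n) : 'I_(n + n + 1) := lshift 1 (lshift n k).
Definition x_idx (k : 'I_n) : 'I_(n + n + 1) := lshift 1 (rshift n k).
Definition y_idx : 'I_(n + n + 1) := rshift (n + n) ord0.

Definition tF (k : 'I_n) : K := ('X_(t_idx k))%:F.
Definition yF : K := ('X_y_idx)%:F.

(* Z[t^+-1, x^+-1, y] is the localization of Z[t, x, y] at the product of all
   t_k and x_k, realized inside the field of fractions. *)
Definition tx_prod : P := \prod_(k < n) ('X_(t_idx k) * 'X_(x_idx k)).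

Definition laurent_pred : {pred K} :=
  [pred f : K | `[< exists (p : P) (m : nat), f = p%:F / tx_prod%:F ^+ m >]].

Lemma laurentP (f : K) :
  reflect (exists (p : P) (m : nat), f = p%:F / tx_prod%:F ^+ m)
          (f \in laurent_pred).
Proof. exact: asboolP. Qed.

Lemma mpolyX_neq0 (k : 'I_(n + n + 1)) : 'X_k != 0 :> P.
Proof. by rewrite -msize_poly_eq0 msizeX. Qed.

Lemma tx_prod_neq0 : tx_prod%:F != 0 :> K.
Proof.
rewrite tofrac_eq0; apply/prodf_neq0 => k _.
by rewrite mulf_neq0 // mpolyX_neq0.
Qed.

Lemma laurent_subring_closed : subring_closed laurent_pred.
Proof.
have d0 m : tx_prod%:F ^+ m != 0 :> K by rewrite expf_neq0 // tx_prod_neq0.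
split.
- by apply/laurentP; exists 1, 0%N; rewrite expr0 divr1 rmorph1.
- move=> f g /laurentP [p [a ->]] /laurentP [q [b ->]]; apply/laurentP.
  exists (p * tx_prod ^+ b - q * tx_prod ^+ a), (a + b)%N.
  rewrite -mulNr addf_div ?d0 //.
  by rewrite rmorphB !rmorphM !rmorphXn exprD mulNr.
- move=> f g /laurentP [p [a ->]] /laurentP [q [b ->]]; apply/laurentP.
  by exists (p * q), (a + b)%N; rewrite mulf_div rmorphM exprD.
Qed.

HB.instance Definition _ :=
  GRing.isSubringClosed.Build K laurent_pred laurent_subring_closed.

Record laurent :=
  Laurent { laurent_val : K; _ : laurent_val \in laurent_pred }.

HB.instance Definition _ := [isSub for laurent_val].
HB.instance Definition _ := [Choice of laurent by <:].
HB.instance Definition _ := [SubChoice_isSubComNzRing of laurent by <:].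

Lemma laurent_poly (p : P) : p%:F \in laurent_pred.
Proof. by apply/laurentP; exists p, 0%N; rewrite expr0 divr1. Qed.

Definition yL : laurent := Laurent (laurent_poly 'X_y_idx).

Lemma tF_neq0 k : tF k != 0.
Proof. by rewrite tofrac_eq0 mpolyX_neq0. Qed.

Lemma laurent_t k : tF k \in laurent_pred.
Proof. exact: laurent_poly. Qed.

Lemma laurent_tV k : (tF k)^-1 \in laurent_pred.
Proof.
set c : P := 'X_(x_idx k) * \prod_(l < n | l != k) ('X_(t_idx l) * 'X_(x_idx l)).
have dE : tx_prod = 'X_(t_idx k) * c by rewrite /tx_prod (bigD1 k) //= mulrA.
have c0 : c%:F != 0 :> K.
  by have := tx_prod_neq0; rewrite dE tofracM mulf_eq0 => /norP[].
apply/laurentP; exists c, 1%N.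
clearbody c; by rewrite expr1 dE tofracM invfM mulrCA divff // mulr1.
Qed.

(* The exchange of t_i and t_j, extended from polynomials to fractions. *)
Definition swap_poly (i j : 'I_n) : P -> P :=
  msym (tperm (t_idx i) (t_idx j)).

Definition swapF (i j : 'I_n) (f : K) : K :=
  (swap_poly i j \n_(repr f))%:F / (swap_poly i j \d_(repr f))%:F.

Lemma swap_poly_eq0 i j (p : P) : (swap_poly i j p == 0) = (p == 0).
Proof.
by rewrite -(inj_eq (@inj_msym _ int (tperm (t_idx i) (t_idx j))) p) msym0.
Qed.

Lemma repr_frac (f : K) : f = (\n_(repr f))%:F / (\d_(repr f))%:F.
Proof.
have piX (r : {ratio P}) : (\pi_K r)%qT * (\d_r)%:F = (\n_r)%:F.
  apply/eqP; rewrite !piE FracField.equivfE /FracField.mulf.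
  rewrite !numden_Ratio ?mulf_neq0 ?oner_eq0 ?denom_ratioP //.
  by rewrite !mulr1 mulrC.
have d0 : (\d_(repr f))%:F != 0 :> K by rewrite tofrac_eq0 denom_ratioP.
by rewrite -piX reprK mulfK.
Qed.

Lemma swapF_frac i j (p q : P) : q != 0 ->
  swapF i j (p%:F / q%:F) = (swap_poly i j p)%:F / (swap_poly i j q)%:F.
Proof.
move=> q0; set f := p%:F / q%:F.
have d0 := denom_ratioP (repr f).
have e : p * \d_(repr f) = \n_(repr f) * q.
  apply/eqP; rewrite -tofrac_eq !rmorphM /= -eqr_div ?tofrac_eq0 //.
  by rewrite -repr_frac.
apply/eqP; rewrite /swapF eqr_div ?tofrac_eq0 ?swap_poly_eq0 //.
by rewrite -!rmorphM /= -e.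
Qed.

Lemma swap_polyXn i j (p : P) m : swap_poly i j (p ^+ m) = swap_poly i j p ^+ m.
Proof. exact: rmorphXn. Qed.

Lemma swap_polyX i j k :
  swap_poly i j 'X_k = 'X_(tperm (t_idx i) (t_idx j) k).
Proof.
rewrite /swap_poly msymX; congr 'X_[_]; apply/mnmP => l.
by rewrite mnmE !mnmE tpermV (canF_eq (tpermK _ _)).
Qed.

Lemma swap_poly_tx_prod i j : swap_poly i j tx_prod = tx_prod.
Proof.
rewrite /tx_prod /swap_poly rmorph_prod /=.
under eq_bigr do rewrite rmorphM /= -!/(swap_poly i j _) !swap_polyX.
rewrite !big_split /=; congr (_ * _).
  rewrite [RHS](reindex_inj (@perm_inj _ (tperm i j))) /=.
  apply: eq_bigr => k _; congr 'X_(_).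
  by rewrite inj_tperm //; move=> a b /lshift_inj/lshift_inj.
apply: eq_bigr => k _; congr 'X_(_).
by rewrite tpermD // /x_idx /t_idx (inj_eq (@lshift_inj _ _)) eq_lrshift.
Qed.

Lemma swap_poly_dvd i j (p : P) :
  exists q, p - swap_poly i j p = q * ('X_(t_idx j) - 'X_(t_idx i)).
Proof.
set d := 'X_(t_idx j) - 'X_(t_idx i).
pose D (p : P) := exists q, p - swap_poly i j p = q * d.
have D0 : D 0 by exists 0; rewrite /swap_poly rmorph0 subrr mul0r.
have D1 : D 1 by exists 0; rewrite /swap_poly rmorph1 subrr mul0r.
have DD a b : D a -> D b -> D (a + b).
  move=> [u hu] [v hv]; exists (u + v).
  by rewrite /swap_poly rmorphD opprD addrACA hu hv mulrDl.
have DM a b : D a -> D b -> D (a * b).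
  move=> [u hu] [v hv]; exists (u * b + swap_poly i j a * v).
  by rewrite mulrDl mulrAC -hu -mulrA -hv /swap_poly rmorphM /=; ring.
have DZ c a : D a -> D (c *: a).
  move=> [u hu]; exists (c *: u).
  by rewrite /swap_poly msymZ -scalerBr hu scalerAl.
have DX k : D 'X_k.
  rewrite /D swap_polyX.
  case: tpermP => [->|->|_ _].
  - by exists (-1); rewrite mulN1r opprB.
  - by exists 1; rewrite mul1r.
  - by exists 0; rewrite subrr mul0r.
change (D p); rewrite (mpolyE p).
apply: (big_ind D) => // m _; apply: DZ.
rewrite mpolyXE_id; apply: (big_ind D) => // k _.
by elim: (m k) => [|e IH]; rewrite ?expr0 // exprS; apply: DM.
Qed.

Lemma tF_inj : injective tF.
Proof.
move=> a b /eqP; rewrite tofrac_eq => /eqP /(congr1 (mcoeff U_(t_idx a))).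
rewrite !mcoeffX eqxx eq_mnm1 => /eqP.
by case: (t_idx b =P t_idx a) => [/lshift_inj/lshift_inj -> // | _]; rewrite oner_eq0.
Qed.

Lemma laurent_swap i j f : f \in laurent_pred -> swapF i j f \in laurent_pred.
Proof.
move=> /laurentP [p [m ->]]; apply/laurentP; exists (swap_poly i j p), m.
rewrite -tofracXn swapF_frac; last first.
  by rewrite -tofrac_eq0 tofracXn expf_neq0 // tx_prod_neq0.
by rewrite swap_polyXn swap_poly_tx_prod tofracXn.
Qed.

Lemma laurent_swap_dvd i j f : f \in laurent_pred ->
  exists2 g, g \in laurent_pred & f - swapF i j f = g * (tF j - tF i).
Proof.
move=> /laurentP [p [m ->]]; have [q hq] := swap_poly_dvd i j p.
exists (q%:F / tx_prod%:F ^+ m); first by apply/laurentP; exists q, m.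
rewrite -tofracXn swapF_frac; last first.
  by rewrite -tofrac_eq0 tofracXn expf_neq0 // tx_prod_neq0.
rewrite swap_polyXn swap_poly_tx_prod.
by rewrite -mulrBl -tofracB hq tofracM tofracB mulrAC.
Qed.

Lemma laurent_geom i j (c : int) : i != j ->
  ((tF i / tF j) ^ c - 1) / (1 - tF i / tF j) \in laurent_pred.
Proof.
move=> ij; set u := tF i / tF j.
have uL : u \in laurent_pred by rewrite rpredM ?laurent_t ?laurent_tV.
have uVL : u^-1 \in laurent_pred.
  by rewrite invf_div rpredM ?laurent_t ?laurent_tV.
have u0 : u != 0 by rewrite mulf_neq0 ?invr_eq0 ?tF_neq0.
have u1 : 1 - u != 0.
  rewrite subr_eq0 eq_sym; apply: contraNneq ij => /divr1_eq /tF_inj ->.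
  exact: eqxx.
clearbody u; have geom (v : K) e : v \in laurent_pred -> 
    exists2 g, g \in laurent_pred & v ^+ e - 1 = g * (1 - v).
  move=> vL; exists (- \sum_(k < e) v ^+ k).
    by rewrite rpredN rpred_sum // => k _; rewrite rpredX.
  by rewrite subrX1; ring.
case: c => e.
  by have [g gL ->] := geom _ e uL; rewrite mulfK.
have [g gL gE] := geom _ e.+1 uVL.
rewrite NegzE -exprz_inv -exprnP gE.
have -> : 1 - u^-1 = - u^-1 * (1 - u) by rewrite mulrBr mulr1 !mulNr mulVf // opprK addrC.
by rewrite mulrA mulfK // rpredM // rpredN.
Qed.

End LaurentRing.

Section Operators.
Variables (R : realType) (n : nat).

Local Notation K := (ratfun_txy n).

(* The value i : 'I_n.-1 (counted from 0) stands for the simple transposition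
   exchanging the positions i and i + 1 of 'I_n. *)
Definition ord_lo (i : 'I_n.-1) : 'I_n := widen_ord (leq_pred n) i.

Lemma ord_hi_subproof (i : 'I_n.-1) : (i.+1 < n)%N.
Proof. by rewrite -ltn_predRL. Qed.

Definition ord_hi (i : 'I_n.-1) : 'I_n := Ordinal (ord_hi_subproof i).

Definition s_act (i : 'I_n.-1) (lam : 'rV[R]_n) : 'rV[R]_n :=
  \row_k lam 0 (tperm (ord_lo i) (ord_hi i) k).

Definition generic_weight (lam : 'rV[R]_n) : Prop :=
  forall j k : 'I_n, j != k -> lam 0 j - lam 0 k \isn't a Num.int.

(* T^L_{i,lam} is computed in the field of fractions; laurent_TF shows that it
   preserves the Laurent polynomials. *)
Definition TF (i : 'I_n.-1) (lam : 'rV[R]_n) (f : K) : K :=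
  let t := tF (ord_lo i) in
  let t' := tF (ord_hi i) in
  (1 + yF n) * (t / t') ^ (1 - Num.ceil (lam 0 (ord_lo i) - lam 0 (ord_hi i)))
    / (1 - t / t') * f
  + (1 + yF n * (t' / t)) / (1 - t' / t) * swapF (ord_lo i) (ord_hi i) f.

Lemma ord_lo_neq_hi (i : 'I_n.-1) : ord_lo i != ord_hi i.
Proof. by rewrite -val_eqE /= neq_ltn ltnSn. Qed.

Lemma laurent_TF i lam f :
  f \in @laurent_pred n -> TF i lam f \in @laurent_pred n.
Proof.
move=> fL; rewrite /TF.
have ij := ord_lo_neq_hi i.
move: (ord_lo i) (ord_hi i) ij => a b ab.
set c := 1 - _; have ggL := laurent_geom c ab.
have [h hL hE] := laurent_swap_dvd a b fL.
have sL := laurent_swap a b fL.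
have a0 := tF_neq0 a; have b0 := tF_neq0 b.
have d0 : tF b - tF a != 0.
  by rewrite subr_eq0; apply: contraNneq ab => /tF_inj ->; exact: eqxx.
have yL : yF n \in @laurent_pred n by exact: laurent_poly.
set U := (tF a / tF b) ^ c in ggL *.
set g := (U - 1) / _ in ggL.
suff -> : (1 + yF n) * U / (1 - tF a / tF b) * f
  + (1 + yF n * (tF b / tF a)) / (1 - tF b / tF a) * swapF a b f
  = (1 + yF n) * g * f + (1 + yF n) * tF b * h + swapF a b f.
  have y1L : 1 + yF n \in @laurent_pred n := rpredD (rpred1 _) yL.
  have tbL := laurent_t b.
  exact: rpredD (rpredD (rpredM (rpredM y1L ggL) fL)
                        (rpredM (rpredM y1L tbL) hL)) sL.
have -> : h = (f - swapF a b f) / (tF b - tF a) by rewrite hE (mulfK d0).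
exact: TF_split a0 b0 d0.
Qed.

Definition TL (i : 'I_n.-1) (lam : 'rV[R]_n) (f : laurent n) : laurent n :=
  Laurent (laurent_TF i lam (valP f)).

End Operators.

(* Main.v *)
Require Import Defs.
From HB Require Import structures.
From mathcomp Require Import all_boot all_order all_algebra.
From mathcomp Require Import fingroup perm generic_quotient ring lra zify.
From mathcomp Require Import mpoly.
From mathcomp Require Import reals.

Set Implicit Arguments.
Unset Strict Implicit.
Unset Printing Implicit Defensive.

Import Order.TTheory GRing.Theory Num.Theory.
Local Open Scope ring_scope.

(** Both relations are identities between operators f |-> A f + B s(f) on a
field F, where s is an automorphism, A is [dl_mult y u k] and B is [dl_refl y u],
u being the ratio t_i / t_{i+1} and k the ceiling of lambda_i - lambda_{i+1}.
Composing such operators, moving the automorphisms past the coefficients and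
collecting terms turns each relation into finitely many identities of rational
functions, one for each element of the Weyl group that occurs. The powers u ^ k
and v ^ k enter them only as nonzero elements, so [field] can decide them.

In rank one, s u = u^-1. The coefficient of s vanishes and that of the identity
is -y as soon as the two exponents k and l satisfy k + l = 1
([dl_op_quadratic]). The two ceilings are those of d and -d with
d = lambda_i - lambda_{i+1}, and they add up to 1 exactly because d is not an
integer ([ceilN_nonint]).

In rank two, set u = t_i / t_{i+1} and v = t_{i+1} / t_{i+2}, and let p, q, r be
the ceilings of the three differences lambda_i - lambda_{i+1},
lambda_{i+1} - lambda_{i+2} and lambda_i - lambda_{i+2}. Following the weights
along the two reduced words of the longest element, one side uses the exponents
p, r, q in order of application and the other q, r, p ([dl_op_braid]). The terms
of length at least two agree at sight; the identity and the two simple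
reflections leave the identities [dl_braid_id] and [dl_braid_refl], which hold
for r = p + q and for r = p + q - 1. These are the only possible values, since a
ceiling of a sum falls short of the sum of the ceilings by at most one
([ceilD_almost_sum]), so the relation holds for every weight.

To apply this to the Laurent polynomials one works in their field of fractions:
the exchange of two t-variables extends there to a field automorphism, and these
automorphisms satisfy the relations of the symmetric group. *)

(** * Demazure-Lusztig operators over a field *)

Definition dl_mult (F : fieldType) (y u : F) (k : int) : F :=
  (1 + y) * u ^ (1 - k) / (1 - u).

Definition dl_refl (F : fieldType) (y u : F) : F :=
  (1 + y * u^-1) / (1 - u^-1).

Definition dl_op (F : fieldType) (s : F -> F) (y u : F) (k : int) (f : F) : F :=
  dl_mult y u k * f + dl_refl y u * s f.

(** Leaves u ^ k as the only integer power, an atom for [field]. *)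
Lemma expfz1B (F : fieldType) (u : F) (k : int) :
  u != 0 -> u ^ (1 - k) = u / u ^ k.
Proof. by move=> u0; rewrite expfzDr // expr1z -invr_expz. Qed.

Lemma rmorph_dl_mult (F : fieldType) (s : {rmorphism F -> F}) (y u : F) k :
  s y = y -> s (dl_mult y u k) = dl_mult y (s u) k.
Proof.
move=> sy; rewrite /dl_mult.
by rewrite !(rmorphM, fmorphV, rmorphD, rmorphN, rmorph1, fmorphXz) /= sy.
Qed.

Lemma rmorph_dl_refl (F : fieldType) (s : {rmorphism F -> F}) (y u : F) :
  s y = y -> s (dl_refl y u) = dl_refl y (s u).
Proof.
move=> sy; rewrite /dl_refl.
by rewrite !(rmorphM, fmorphV, rmorphD, rmorphN, rmorph1) /= sy.
Qed.

Lemma rmorph_dl_op (F : fieldType) (s : {rmorphism F -> F}) (s' : F -> F)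
    (y u : F) k f : s y = y ->
  s (dl_op s' y u k f) = dl_mult y (s u) k * s f + dl_refl y (s u) * s (s' f).
Proof.
move=> sy; rewrite -rmorph_dl_mult // -rmorph_dl_refl // rmorphD.
by congr (_ + _); apply: rmorphM.
Qed.

(** The condition k + l = 1 makes the coefficient of s f vanish: s inverts u, so
moving s past the first multiplier gives a power of u that has to match the
second one. *)
Lemma dl_op_quadratic (F : fieldType) (s : {rmorphism F -> F}) (y u : F) k l f :
  involutive s -> s y = y -> s u = u^-1 -> u != 0 -> 1 - u != 0 -> k + l = 1 ->
  dl_op s y u l (dl_op s y u k f) = - y * f.
Proof.
move=> sK sy su u0 u1 kl; have ->: l = 1 - k by rewrite -kl addrC addKr.
rewrite {1}/dl_op rmorph_dl_op // sK su /dl_op.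
have cancels : dl_mult y u (1 - k) + dl_mult y u^-1 k = 0.
  rewrite /dl_mult subKr exprz_inv opprB expfzDr // exprN1.
  by field; rewrite u0 u1 -opprB oppr_eq0 u1.
have eqy : dl_mult y u (1 - k) * dl_mult y u k
           + dl_refl y u * dl_refl y u^-1 = - y.
  rewrite /dl_mult /dl_refl subKr expfz1B //.
  have uk0 : u ^ k != 0 by rewrite expfz_neq0.
  by field; rewrite u0 oner_eq0 u1 -opprB oppr_eq0 u1 uk0.
transitivity ((dl_mult y u (1 - k) * dl_mult y u k
               + dl_refl y u * dl_refl y u^-1) * f
  + (dl_mult y u (1 - k) + dl_mult y u^-1 k) * dl_refl y u * s f); first by ring.
by rewrite cancels eqy !mul0r addr0.
Qed.

(** The possible relations between the ceilings p, q of two reals and the ceiling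
r of their sum. *)
Definition almost_sum (r p q : int) : bool := (r == p + q) || (r == p + q - 1).

(** The coefficient of f in the braid relation. Take r = p + q and divide by the
common factor (1 + y) (u v)^(1 - p - q). Expanding
(u + y)(1 + y u) = (1 + y)^2 u + y (1 - u)^2, the left side becomes
(1 + y)^2 u / (1 - u)^2 (1 / (1 - v) - 1 / (1 - u v)) - y / (1 - u v).
The difference in the middle equals v (1 - u) / ((1 - v)(1 - u v)), so that the
whole is symmetric in u and v, and the right side is its image under their
exchange. The case r = p + q - 1 is similar. *)
Lemma dl_braid_id (F : fieldType) (y u v : F) p q r :
  u != 0 -> v != 0 -> 1 - u != 0 -> 1 - v != 0 -> 1 - u * v != 0 ->
  almost_sum r p q ->
  dl_mult y u q * dl_mult y v r * dl_mult y u p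
    + dl_refl y u * dl_mult y (u * v) r * dl_refl y u^-1
  = dl_mult y v p * dl_mult y u r * dl_mult y v q
    + dl_refl y v * dl_mult y (u * v) r * dl_refl y v^-1.
Proof.
move=> u0 v0 u1 v1 uv1 pqr.
have up0 := expfz_neq0 p u0; have uq0 := expfz_neq0 q u0.
have vp0 := expfz_neq0 p v0; have vq0 := expfz_neq0 q v0.
have u1' : u - 1 != 0 by rewrite -opprB oppr_eq0.
have v1' : v - 1 != 0 by rewrite -opprB oppr_eq0.
rewrite /dl_mult /dl_refl !expfz1B ?mulf_neq0 // !expfzMl.
case/orP: pqr => /eqP ->; rewrite !expfzDr // ?exprN1;
  by field; rewrite ?oner_eq0 ?u0 ?v0 ?u1 ?v1 ?uv1 ?up0 ?uq0 ?vp0 ?vq0 ?u1' ?v1'.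
Qed.

(** The coefficient of s1 f in the braid relation, divided by the common factor
[dl_refl y u]. Exchanging (u, p) with (v, q) gives the coefficient of s2 f. *)
Lemma dl_braid_refl (F : fieldType) (y u v : F) p q r :
  u != 0 -> v != 0 -> 1 - u != 0 -> 1 - v != 0 -> 1 - u * v != 0 ->
  almost_sum r p q ->
  dl_mult y u q * dl_mult y v r + dl_mult y (u * v) r * dl_mult y u^-1 p
  = dl_mult y v p * dl_mult y (u * v) q.
Proof.
move=> u0 v0 u1 v1 uv1 pqr.
have up0 := expfz_neq0 p u0; have uq0 := expfz_neq0 q u0.
have vp0 := expfz_neq0 p v0; have vq0 := expfz_neq0 q v0.
have u1' : u - 1 != 0 by rewrite -opprB oppr_eq0.
rewrite /dl_mult !expfz1B ?mulf_neq0 ?invr_eq0 // !expfzMl.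
rewrite !exprz_inv -!invr_expz.
case/orP: pqr => /eqP ->; rewrite !expfzDr // ?exprN1;
  by field; rewrite ?oner_eq0 ?u0 ?v0 ?u1 ?v1 ?uv1 ?up0 ?uq0 ?vp0 ?vq0 ?u1'.
Qed.

(** The assumptions on s1, s2, u, v are the action of the Weyl group of type A2 on
the exponentials u and v of the simple roots. *)
Lemma dl_op_braid (F : fieldType) (s1 s2 : {rmorphism F -> F}) (y u v : F)
    (p q r : int) (f : F) :
  involutive s1 -> involutive s2 ->
  (forall g, s1 (s2 (s1 g)) = s2 (s1 (s2 g))) ->
  s1 y = y -> s2 y = y ->
  s1 u = u^-1 -> s1 v = u * v -> s2 u = u * v -> s2 v = v^-1 ->
  u != 0 -> v != 0 -> 1 - u != 0 -> 1 - v != 0 -> 1 - u * v != 0 ->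
  almost_sum r p q ->
  dl_op s1 y u q (dl_op s2 y v r (dl_op s1 y u p f)) =
  dl_op s2 y v p (dl_op s1 y u r (dl_op s2 y v q f)).
Proof.
move=> s1K s2K s12 s1y s2y s1u s1v s2u s2v u0 v0 u1 v1 uv1 pqr.
have s1uv : s1 (u * v) = v by rewrite rmorphM /= s1u s1v mulKf.
have s2uv : s2 (u * v) = u by rewrite rmorphM /= s2u s2v mulfK.
(* Composites of s1 and s2 are moved across an operator in one step, so that the
   coefficients stay in the form [dl_mult] and [dl_refl]. *)
have s12_op s' w k g : s1 (s2 (dl_op s' y w k g)) =
    dl_mult y (s1 (s2 w)) k * s1 (s2 g) + dl_refl y (s1 (s2 w)) * s1 (s2 (s' g)).
  have /= := @rmorph_dl_op F (s1 \o s2)%FUN s' y w k g.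
  by rewrite s2y => /(_ s1y).
have s21_op s' w k g : s2 (s1 (dl_op s' y w k g)) =
    dl_mult y (s2 (s1 w)) k * s2 (s1 g) + dl_refl y (s2 (s1 w)) * s2 (s1 (s' g)).
  have /= := @rmorph_dl_op F (s2 \o s1)%FUN s' y w k g.
  by rewrite s1y => /(_ s2y).
rewrite {1 4}/dl_op (@rmorph_dl_op F s1 s2) // s12_op.
rewrite (@rmorph_dl_op F s2 s1) // s21_op.
rewrite [dl_op s2 y v r _]/dl_op [dl_op s1 y u r _]/dl_op.
rewrite !rmorph_dl_op // s12 s1K s2K.
rewrite s1u s1v s2u s2v s1uv s2uv /dl_op.
have vu1 : 1 - v * u != 0 by rewrite mulrC.
have qpr : almost_sum r q p by rewrite /almost_sum addrC.
have c1 := dl_braid_id y u0 v0 u1 v1 uv1 pqr.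
have c2 := dl_braid_refl y u0 v0 u1 v1 uv1 pqr.
have c3 := dl_braid_refl y v0 u0 v1 u1 vu1 qpr.
rewrite (mulrC v u) in c3.
move: c1 c2 c3.
set Auq := dl_mult y u q; set Avr := dl_mult y v r; set Aup := dl_mult y u p.
set Bu := dl_refl y u; set Auvr := dl_mult y (u * v) r.
move=> c1 c2 c3.
(* The six terms are indexed by the elements of S_3. *)
transitivity ((Auq * Avr * Aup + Bu * Auvr * dl_refl y u^-1) * f
  + (Auq * Avr + Auvr * dl_mult y u^-1 p) * Bu * s1 f
  + Auq * dl_mult y (u * v) p * dl_refl y v * s2 f
  + Bu * dl_refl y (u * v) * dl_mult y v p * s1 (s2 f)
  + Auq * dl_refl y v * dl_refl y (u * v) * s2 (s1 f)
  + Bu * dl_refl y (u * v) * dl_refl y v * s2 (s1 (s2 f))); first by ring.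
rewrite c1 c2 -c3; ring.
Qed.

(** * The exchange of two t-variables on the field of fractions *)

Section SwapF.
Variable n : nat.

Local Notation P := (poly_txy n).
Local Notation K := (ratfun_txy n).
Local Notation "p %:F" := (@tofrac P p).

Lemma fracP (f : K) : exists (p q : P), q != 0 /\ f = p%:F / q%:F.
Proof.
exists (\n_(repr f)), (\d_(repr f)).
by split; [exact: denom_ratioP | exact: repr_frac].
Qed.

Lemma swapF_poly i j (p : P) : swapF i j p%:F = (swap_poly i j p)%:F.
Proof.
rewrite -[p%:F in LHS]divr1 -tofrac1 swapF_frac ?oner_eq0 //.
by rewrite /swap_poly msym1 tofrac1 divr1.
Qed.

Lemma swapF_is_zmod_morphism i j : zmod_morphism (@swapF n i j).
Proof.
move=> f g; have [p [q [q0 ->]]] := fracP f; have [p' [q' [q'0 ->]]] := fracP g.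
have F0 (a : P) : a != 0 -> a%:F != 0 :> K by rewrite tofrac_eq0.
have S0 (a : P) : a != 0 -> (swap_poly i j a)%:F != 0 :> K.
  by move=> a0; rewrite F0 // swap_poly_eq0.
rewrite -mulNr addf_div ?F0 // mulNr -!tofracM -tofracB.
rewrite !swapF_frac ?mulf_neq0 // -[in RHS]mulNr addf_div ?S0 // [in RHS]mulNr.
by rewrite -!tofracM -tofracB /swap_poly rmorphB !rmorphM.
Qed.

Lemma swapF_is_monoid_morphism i j : monoid_morphism (@swapF n i j).
Proof.
split; first by rewrite -tofrac1 swapF_poly /swap_poly msym1.
move=> f g; have [p [q [q0 ->]]] := fracP f; have [p' [q' [q'0 ->]]] := fracP g.
rewrite mulf_div -!tofracM !swapF_frac ?mulf_neq0 // mulf_div -!tofracM.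
by rewrite /swap_poly !rmorphM.
Qed.

HB.instance Definition _ i j :=
  GRing.isZmodMorphism.Build K K (@swapF n i j) (swapF_is_zmod_morphism i j).
HB.instance Definition _ i j :=
  GRing.isMonoidMorphism.Build K K (@swapF n i j) (swapF_is_monoid_morphism i j).

Lemma t_idx_inj : injective (@t_idx n).
Proof. by move=> a b /lshift_inj/lshift_inj. Qed.

Lemma swapF_t (i j k : 'I_n) : swapF i j (tF k) = tF (tperm i j k).
Proof.
rewrite [in LHS]/tF swapF_poly swap_polyX -inj_tperm //.
exact: t_idx_inj.
Qed.

Lemma swapF_ratio (i j k l : 'I_n) :
  swapF i j (tF k / tF l) = tF (tperm i j k) / tF (tperm i j l).
Proof. by rewrite rmorphM fmorphV /= !swapF_t. Qed.

Lemma swapF_y i j : swapF i j (yF n) = yF n.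
Proof.
by rewrite [in LHS]/yF swapF_poly swap_polyX tpermD // /t_idx /y_idx eq_lrshift.
Qed.

Lemma swapFK i j : involutive (@swapF n i j).
Proof.
move=> f; have [p [q [q0 ->]]] := fracP f.
by rewrite !swapF_frac ?swap_poly_eq0 // /swap_poly -!msymMm tperm2 !msym1m.
Qed.

Lemma swapF_braid i j k (f : K) : i != j -> j != k -> i != k ->
  swapF i j (swapF j k (swapF i j f)) = swapF j k (swapF i j (swapF j k f)).
Proof.
move=> ij jk ik; have [p [q [q0 ->]]] := fracP f.
have inj := inj_eq t_idx_inj.
have braid : (tperm (t_idx i) (t_idx j) * (tperm (t_idx j) (t_idx k)
    * tperm (t_idx i) (t_idx j)) = tperm (t_idx j) (t_idx k)
    * (tperm (t_idx i) (t_idx j) * tperm (t_idx j) (t_idx k)))%g.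
  (* Each word is the conjugate of one transposition by the other: (i k). *)
  rewrite -{1}[tperm (t_idx i) (t_idx j)]tpermV -[(_^-1 * _)%g]/(_ ^ _)%g tpermJ.
  rewrite -{1}[tperm (t_idx j) (t_idx k)]tpermV -[(_^-1 * _)%g]/(_ ^ _)%g tpermJ.
  by rewrite !tpermR !tpermL !tpermD ?inj 1?eq_sym // 1?eq_sym.
by rewrite !swapF_frac ?swap_poly_eq0 // /swap_poly -!msymMm braid.
Qed.

Lemma tF_ratio_neq0 (j k : 'I_n) : tF j / tF k != 0.
Proof. by rewrite mulf_neq0 ?invr_eq0 ?tF_neq0. Qed.

Lemma tF_ratio_neq1 (j k : 'I_n) : j != k -> 1 - tF j / tF k != 0.
Proof.
move=> jk; rewrite subr_eq0 eq_sym.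
by apply: contraNneq jk => /divr1_eq /tF_inj ->.
Qed.

End SwapF.

(** * Ceilings of differences of weights, and the relations *)

Lemma TF_dl_op (R : realType) (n : nat) (i : 'I_n.-1) (lam : 'rV[R]_n) f :
  TF i lam f = dl_op (swapF (ord_lo i) (ord_hi i)) (yF n)
    (tF (ord_lo i) / tF (ord_hi i))
    (Num.ceil (lam 0 (ord_lo i) - lam 0 (ord_hi i))) f.
Proof. by rewrite /TF /dl_op /dl_mult /dl_refl invf_div. Qed.

Lemma ceilN_nonint (R : realType) (a : R) :
  a \isn't a Num.int -> Num.ceil a + Num.ceil (- a) = 1.
Proof.
move=> na; rewrite ceil_floor na [in X in _ + X]ceilNfloor opprK.
by rewrite addrAC subrr add0r.
Qed.

Lemma ceilD_almost_sum (R : realType) (a b : R) :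
  almost_sum (Num.ceil (a + b)) (Num.ceil a) (Num.ceil b).
Proof.
have /andP[a1 a2] := ceil_itv a; have /andP[b1 b2] := ceil_itv b.
have le : Num.ceil (a + b) <= Num.ceil a + Num.ceil b.
  by rewrite ceil_le_int rmorphD lerD.
have gt : Num.ceil a + Num.ceil b - 2 < Num.ceil (a + b).
  by rewrite ceil_gt_int !rmorphB !rmorphD /=; move: a1 b1; rewrite !rmorphB /=; lra.
by rewrite /almost_sum; lia.
Qed.

Theorem proposition11p9 (R : realType) (n : nat) (lam : 'rV[R]_n) :
  (generic_weight lam ->
   forall i : 'I_n.-1,
     TL i (s_act i lam) \o TL i lam =1 (fun f : laurent n => - yL n * f))
  /\
  (forall i j : 'I_n.-1, j = i.+1 :> nat ->
     TL i (s_act j (s_act i lam)) \o TL j (s_act i lam) \o TL i lam =1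
     TL j (s_act i (s_act j lam)) \o TL i (s_act j lam) \o TL j lam).
Proof.
split=> [gen i f|i j ij f]; apply: val_inj.
  change (TF i (s_act i lam) (TF i lam (val f)) = - yF n * val f).
  have lohi := ord_lo_neq_hi i.
  rewrite !TF_dl_op !mxE tpermL tpermR; apply: dl_op_quadratic.
  - exact: swapFK.
  - exact: swapF_y.
  - by rewrite /= swapF_ratio tpermL tpermR invf_div.
  - exact: tF_ratio_neq0.
  - exact: tF_ratio_neq1.
  - by rewrite -[X in Num.ceil X + _]opprB addrC ceilN_nonint // gen // eq_sym.
change (TF i (s_act j (s_act i lam)) (TF j (s_act i lam) (TF i lam (val f))) =
  TF j (s_act i (s_act j lam)) (TF i (s_act j lam) (TF j lam (val f)))).
rewrite !TF_dl_op !mxE.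
(* The two simple reflections act on three consecutive positions a, b, c. *)
have -> : ord_lo j = ord_hi i by apply: val_inj.
have ab := ord_lo_neq_hi i.
have bc : ord_hi i != ord_hi j by rewrite -val_eqE /= ij; lia.
have ac : ord_lo i != ord_hi j by rewrite -val_eqE /= ij; lia.
move: (ord_lo i) (ord_hi i) (ord_hi j) ab bc ac => a b c ab bc ac.
have abcE : tF a / tF b * (tF b / tF c) = tF a / tF c.
  by rewrite mulrA divfK ?tF_neq0.
have tabc : tperm a b c = c by rewrite tpermD.
have tbca : tperm b c a = a by rewrite tpermD // eq_sym.
rewrite !(tabc, tbca, tpermL, tpermR).
apply: dl_op_braid.
- exact: swapFK.
- exact: swapFK.
- by move=> g; apply: swapF_braid.
- exact: swapF_y.
- exact: swapF_y.
- by rewrite /= swapF_ratio tpermL tpermR invf_div.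
- by rewrite /= swapF_ratio tabc tpermR abcE.
- by rewrite /= swapF_ratio tbca tpermL abcE.
- by rewrite /= swapF_ratio tpermL tpermR invf_div.
- exact: tF_ratio_neq0.
- exact: tF_ratio_neq0.
- exact: tF_ratio_neq1.
- exact: tF_ratio_neq1.
- by rewrite abcE; exact: tF_ratio_neq1.
have -> : lam 0 a - lam 0 c = (lam 0 a - lam 0 b) + (lam 0 b - lam 0 c).
  by rewrite addrA subrK.
exact: ceilD_almost_sum.
Qed.
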